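(* Let $0<p\le1$. There exists a constant $c_p$, depending only on $p$, such that for every $n\in\mathbb{N}_+$ and every $F\in H_p(G)$ $$\|S_{2^n+2^{n-1}}F\|_{H_p}\le c_p\|F\|_{H_p}.$$
   Context: $\mathbb{N}_+$ is the set of positive integers and $\mathbb{N}=\mathbb{N}_+\cup\{0\}$. $G=\prod_{k=0}^\infty Z_2$ is the dyadic (Walsh) group, i.e. the set of sequences $x=(x_0,x_1,\dots)$, $x_k\in\{0,1\}$, with coordinatewise addition mod 2, product topology, and normalized Haar measure $\mu$ (the product of the measures giving mass $1/2$ to each point of $Z_2$). Put $I_0(x)=G$, $I_n(x)=\{y\in G: y_0=x_0,\dots,y_{n-1}=x_{n-1}\}$, and let $\zeta_n$ be the $\sigma$-algebra generated by $\{I_n(x):x\in G\}$. Rademacher functions: $r_k(x)=(-1)^{x_k}$. Walsh functions: $w_n(x)=\prod_{k\ge0}r_k(x)^{n_k}$, where $n=\sum_{k\ge0}n_k2^k$, $n_k\in\{0,1\}$. A martingale $F=(F_n,n\in\mathbb{N})$ is a martingale with respect to $(\zeta_n)_{n\in\mathbb N}$. Its maximal function is $F^*=\sup_n|F_n|$; for $0<p<\infty$, $H_p(G)$ is the space of martingales with $\|F\|_{H_p}:=\|F^*\|_p<\infty$, where $\|f\|_p^p=\int_G|f|^p\,d\mu$. Walsh–Fourier coefficients of a martingale: $\widehat F(k)=\lim_{n\to\infty}\int_GF_nw_k\,d\mu$ (the limit always exists). Partial sums: $S_nF=\sum_{k=0}^{n-1}\widehat F(k)w_k$; in particular $S_{2^n}F=F_n$.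 An integrable function $f$ (such as $S_nF$) is identified with the martingale $(E(f\mid\zeta_n))_{n}$ of its conditional expectations when its $H_p$ quasi-norm is taken. *)

(* Defs.v *)
From HB Require Import structures.
From mathcomp Require Import all_boot all_order all_algebra.
From mathcomp Require Import all_classical all_reals all_analysis.
From mathcomp Require Import zify lra.

Set Implicit Arguments.
Unset Strict Implicit.
Unset Printing Implicit Defensive.

Import Order.TTheory GRing.Theory Num.Theory.
Import numFieldNormedType.Exports.

Local Open Scope classical_set_scope.
Local Open Scope ring_scope.

(* [zmodType] on [nat -> 'Z_2] is coordinatewise addition mod 2. *)
Definition dyadic_seq : Type := nat -> 'Z_2.

HB.instance Definition _ := GRing.Zmodule.copy dyadic_seq (nat -> 'Z_2).
HB.instance Definition _ := isPointed.Build dyadic_seq 0.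

Definition cylinder (n : nat) (x : dyadic_seq) : set dyadic_seq :=
  [set y | forall k, (k < n)%N -> y k = x k].

Definition cylinders : set (set dyadic_seq) :=
  [set A | exists n x, A = cylinder n x].

(* The cylinders are a countable base of the product topology on
   [nat -> 'Z_2], so they generate its Borel sigma-algebra. *)
Definition dyadic : measurableType _ := g_sigma_algebraType cylinders.

Definition zeta (n : nat) : set (set dyadic) := <<s range (cylinder n) >>.

(* A countable product measure is the probability whose value on a rectangle
   restricting finitely many coordinates is the product of the factors; here
   each factor is the uniform probability A |-> #|A| / 2 on 'Z_2.  These values
   determine mu, which is the normalized Haar measure. *)
Definition is_haar (R : realType) (mu : probability dyadic R) : Prop :=
  forall (n : nat) (A : nat -> {set 'Z_2}),
    mu [set x : dyadic | forall k, (k < n)%N -> x k \in A k] =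
    (\prod_(k < n) (#|A k|%:R / 2))%:E.

(* The measure is the image of Lebesgue measure on [0, 1[ under
   x |-> (binary digits of x). *)
Section haar_exists.
Variable R : realType.

Let unit_itv : set (measurableTypeR R) := [set` `[0 : R, 1[].

Let approx (n : nat) (x : R) : nat := Num.truncn (2 ^+ n * x).

Let digits (x : measurableTypeR R) : dyadic :=
  fun k => if (0 <= x < 1) then (approx k.+1 x)%:R else 0.

Let code (a : dyadic_seq) := fix code n : nat :=
  if n is m.+1 then (code m * 2 + a m)%N else 0%N.

Let Z2_lt2 (a : 'Z_2) : (a < 2)%N. Proof. exact: ltn_ord. Qed.

Let code_lt a n : (code a n < 2 ^ n)%N.
Proof. elim: n => //= n IH; have := Z2_lt2 (a n); rewrite expnS; lia. Qed.

Let approx_half n (x : R) : 0 <= x -> approx n x = (approx n.+1 x)./2.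
Proof.
move=> x0; rewrite /approx; apply: truncn_def.
have y0 : 0 <= 2 ^+ n.+1 * x by rewrite mulr_ge0 ?exprn_ge0.
have := truncn_itv y0; set m := Num.truncn _ => /andP[h1 h2].
have e : 2 ^+ n.+1 * x = 2 * (2 ^+ n * x) by rewrite exprS mulrA.
rewrite e in h1 h2.
have em : m%:R = (odd m)%:R + 2 * (m./2)%:R :> R.
  by rewrite -natrM -natrD mul2n odd_double_half.
have eS : m.+1%:R = m%:R + 1 :> R by rewrite -natr1.
have eS' : m./2.+1%:R = m./2%:R + 1 :> R by rewrite -natr1.
have : (odd m)%:R <= 1 :> R by case: odd.
have : 0 <= (odd m)%:R :> R by case: odd.
by rewrite eS em in h2; rewrite em in h1; rewrite eS'; lra.
Qed.

Let digits_cylinder n a (x : R) : 0 <= x < 1 ->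
  cylinder n a (digits x) <-> approx n x = code a n.
Proof.
move=> x01; have x0 : 0 <= x by case/andP: x01.
elim: n => [|n IH].
  split=> //= _; rewrite /approx expr0 mul1r; apply: truncn_def.
  by rewrite mulr0n.
have -> : cylinder n.+1 a (digits x) <->
    cylinder n a (digits x) /\ digits x n = a n.
  split=> [h|[h1 h2] k].
    by split=> [k kn|]; apply: h => //; exact: ltnW.
  by rewrite ltnS leq_eqVlt => /orP[/eqP->//|/h1].
rewrite IH (approx_half n x0) /= /digits x01.
set m := approx _ _.
have -> : (m%:R = a n) <-> (odd m = a n :> nat).
  rewrite -modn2 -(val_Zp_nat (isT : (1 < 2)%N)).
  by split=> [->//|h]; exact: val_inj.
by have := odd_double_half m; have := Z2_lt2 (a n); lia.
Qed.

Let approx_eq n (x : R) c : 0 <= x ->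
  approx n x = c <-> x \in `[c%:R / 2 ^+ n, c.+1%:R / 2 ^+ n[.
Proof.
move=> x0; have p0 : 0 < 2 ^+ n :> R by rewrite exprn_gt0.
rewrite in_itv/= ler_pdivrMr// ltr_pdivlMr// mulrC.
rewrite -truncn_eq ?mulr_ge0// ?ltW//.
by split => [/eqP|/eqP].
Qed.

Let preimage_cylinder n a :
  digits @^-1` cylinder n a `&` unit_itv =
  [set` `[(code a n)%:R / 2 ^+ n : R, (code a n).+1%:R / 2 ^+ n[].
Proof.
have p0 : 0 < 2 ^+ n :> R by rewrite exprn_gt0.
apply/seteqP; split=> x /=.
  rewrite /unit_itv/= in_itv/= => -[h x01].
  by apply/approx_eq; [case/andP: x01|exact/(digits_cylinder _ _ x01)].
move=> xi; have := xi; rewrite in_itv/= => /andP[h1 h2].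
have x01 : 0 <= x < 1.
  apply/andP; split; first by apply: le_trans h1; rewrite divr_ge0// ltW.
  apply: (lt_le_trans h2); rewrite ler_pdivrMr// mul1r -natrX ler_nat.
  exact: code_lt.
split; last by rewrite /unit_itv/= in_itv.
apply/(digits_cylinder _ _ x01)/approx_eq => //.
by case/andP: x01.
Qed.

Let measurable_unit_itv : measurable unit_itv.
Proof. exact: measurable_itv. Qed.

Let measurable_digits : measurable_fun [set: measurableTypeR R] digits.
Proof.
apply: (@measurability _ _ _ dyadic setT digits cylinders) => //.
move=> _ [_ [n [a ->]] <-]; rewrite setTI.
rewrite -(setIT (digits @^-1` _)) -(setUv unit_itv) setIUr.
apply: measurableU; first by rewrite preimage_cylinder; exact: measurable_itv.
have out x : (~` unit_itv) x -> digits x = 0.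
  rewrite /unit_itv/= in_itv/= => h; apply/funext => k; rewrite /digits.
  by case: ifP h => // ->.
have [h|h] := pselect (cylinder n a (0 : dyadic_seq)).
  suff -> : digits @^-1` cylinder n a `&` ~` unit_itv = ~` unit_itv.
    exact: measurableC.
  by apply/seteqP; split=> x /= => [[]//|Ux]; split => //; rewrite out.
suff -> : digits @^-1` cylinder n a `&` ~` unit_itv = set0 by [].
by rewrite -subset0 => x /= [+ Ux]; rewrite out.
Qed.

Let unit_measure : set (measurableTypeR R) -> \bar R :=
  mrestr (@lebesgue_measure R) measurable_unit_itv.

HB.instance Definition _ := Measure.on unit_measure.

Let unit_measure_setT : unit_measure setT = 1%E.
Proof.
by rewrite /unit_measure /mrestr setTI lebesgue_measure_itv/= lte_fin ltr01
  oppr0 adde0.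
Qed.

HB.instance Definition _ :=
  Measure_isProbability.Build _ _ _ unit_measure unit_measure_setT.

HB.instance Definition _ :=
  isMeasurableFun.Build _ _ _ _ digits measurable_digits.

Let nu : probability dyadic R := distribution unit_measure digits.

Let nu_cylinder n a : nu (cylinder n a) = (1 / 2 ^+ n)%:E.
Proof.
have p0 : 0 < 2 ^+ n :> R by rewrite exprn_gt0.
rewrite /nu /= /distribution /pushforward /unit_measure /mrestr.
rewrite preimage_cylinder lebesgue_measure_itv/= lte_fin.
rewrite ltr_pM2r ?invr_gt0// ltr_nat ltnSn -EFinB -mulrBl.
by rewrite -natr1 [X in X - _]addrC addrK.
Qed.

Let rect n (A : nat -> {set 'Z_2}) : set dyadic :=
  [set x | forall k, (k < n)%N -> x k \in A k].

Let upd (A : nat -> {set 'Z_2}) j c k := if k == j then [set c]%SET else A k.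

Let measurable_cylinder n (a : dyadic_seq) :
  measurable (cylinder n a : set dyadic).
Proof. by apply: sub_sigma_algebra; exists n, a. Qed.

Let rect_prefix n A j : (forall k, (j <= k < n)%N -> exists c, A k = [set c]%SET) ->
  measurable (rect n A) /\ nu (rect n A) = (\prod_(k < n) (#|A k|%:R / 2))%:E.
Proof.
elim: j A => [|j IH] A hA.
  have /choice[a ha] : forall k, exists c, (k < n)%N -> A k = [set c]%SET.
    by move=> k; case: (ltnP k n) => [/hA[c ->]|_]; [exists c|exists 0].
  have -> : rect n A = cylinder n a.
    apply/seteqP; split=> x h k kn; have := h k kn; rewrite ?ha// ?inE.
      by move/eqP.
    by move=> ->.
  split; first exact: measurable_cylinder.
  rewrite nu_cylinder (eq_bigr (fun=> 1 / 2)); last first.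
    by move=> i _; rewrite ha// cards1.
  by rewrite prodr_const card_ord expr_div_n expr1n.
have [nj|jn] := leqP n j.
  by apply: IH => k /andP[jk kn]; have := leq_trans kn (leq_trans nj jk);
    rewrite ltnn.
have {}IH c : measurable (rect n (upd A j c)) /\ nu (rect n (upd A j c)) =
    (1 / 2 * \prod_(k < n | k != Ordinal jn) (#|A k|%:R / 2))%:E.
  have [|mr ->] := IH (upd A j c).
    move=> k /andP[jk kn]; rewrite /upd; case: eqP => [_|/eqP kj].
      by exists c.
    by apply: hA; rewrite kn andbT ltn_neqAle eq_sym kj.
  split=> //; congr (_%:E); rewrite (bigD1 (Ordinal jn))//= /upd eqxx cards1.
  congr (_ * _); apply: eq_bigr => i ij; rewrite ifN//.
have Z2 (c : 'Z_2) : c = 0 \/ c = 1.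
  case: c => [[|[|c]] hc]; [left|right|by []]; exact: val_inj.
pose B c : set dyadic := if c \in A j then rect n (upd A j c) else set0.
have mB c : measurable (B c) by rewrite /B; case: ifP => // _; exact: (IH c).1.
have nuB c : nu (B c) =
    ((c \in A j)%:R / 2 * \prod_(k < n | k != Ordinal jn) (#|A k|%:R / 2))%:E.
  by rewrite /B; case: ifP => _; [exact: (IH c).2|rewrite measure0 !mul0r].
have Bj c x : B c x -> x j = c.
  rewrite /B; case: ifP => // _ /(_ j jn).
  by rewrite /upd eqxx inE => /eqP.
have -> : rect n A = B 0 `|` B 1.
  apply/seteqP; split=> [x Ax|x].
    have xB : B (x j) x.
      rewrite /B Ax// => k kn; rewrite /upd.
      by case: eqP => [->|_]; [rewrite inE|exact: Ax].
    by case: (Z2 (x j)) xB => ->; [left|right].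
  have BA c : B c x -> rect n A x.
    rewrite /B; case: ifP => // cA Bx k kn; have := Bx k kn.
    by rewrite /upd; case: eqP => [->|//]; rewrite inE => /eqP ->.
  by case => /BA.
split; first exact: measurableU.
have B01 : B 0 `&` B 1 = set0.
  by rewrite -subset0 => x [/Bj + /Bj] => -> /eqP.
apply: (etrans (measureU nu (mB 0) (mB 1) B01)).
apply: (etrans (congr2 _ (nuB 0) (nuB 1))).
rewrite -EFinD -mulrDl -mulrDl -natrD [in RHS](bigD1 (Ordinal jn))//=.
have -> // : #|A j| = ((0%R \in A j) + (1%R \in A j))%N.
rewrite -sum1_card big_mkcond/= big_ord_recl big_ord1.
have b2n (b : bool) : (if b then 1 else 0)%N = b by case: b.
have -> : lift ord0 ord0 = 1 :> 'Z_2 by exact: val_inj.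
by rewrite !b2n; have -> : ord0 = 0 :> 'Z_2 by exact: val_inj.
Qed.

Lemma haar_exists : exists mu : probability dyadic R, is_haar mu.
Proof.
exists nu => n A; apply: (@rect_prefix n A n _).2 => k /andP[nk kn].
by have := leq_trans kn nk; rewrite ltnn.
Qed.

End haar_exists.

Definition haar (R : realType) : probability dyadic R :=
  sval (cid (haar_exists R)).

Lemma haarP (R : realType) : is_haar (haar R).
Proof. exact: svalP (cid (haar_exists R)). Qed.

Section dyadic_hardy.
Variable R : realType.
Implicit Types (f g : dyadic -> R) (F : nat -> dyadic -> R) (p : R).

Definition rademacher (k : nat) (x : dyadic) : R := (-1) ^+ (x k : nat).

(* As n < 2 ^ n, the binary digits of n of index k >= n vanish. *)
Definition walsh (n : nat) (x : dyadic) : R :=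
  \prod_(k < n) rademacher k x ^+ odd (n %/ 2 ^ k).

Definition measurable_wrt (S : set (set dyadic)) f : Prop :=
  forall B : set R, measurable B -> S (f @^-1` B).

Definition is_cond_exp (S : set (set dyadic)) f g : Prop :=
  [/\ measurable_wrt S g, (haar R).-integrable setT (EFin \o g) &
      forall A, S A ->
        \int[haar R]_(x in A) g x = \int[haar R]_(x in A) f x].

(* On the zeta n, conditional expectations are unique pointwise (not only
   almost everywhere), as the atoms of zeta n have positive measure. *)
Definition cond_exp (S : set (set dyadic)) f : dyadic -> R :=
  xget (fun=> 0) [set g | is_cond_exp S f g].

Definition is_martingale F : Prop :=
  (forall n, (haar R).-integrable setT (EFin \o F n)) /\
  (forall m n, (n <= m)%N -> is_cond_exp (zeta n) (F m) (F n)).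

Definition maximal F (x : dyadic) : \bar R :=
  ereal_sup [set (`|F n x|%:E) | n in [set: nat]].

Definition Hp_norm p F : \bar R := Lnorm (haar R) p%:E (maximal F).

Definition in_Hp p F : Prop := is_martingale F /\ (Hp_norm p F < +oo)%E.

Definition fun_Hp_norm p f : \bar R := Hp_norm p (fun n => cond_exp (zeta n) f).

Definition walsh_coef F (k : nat) : R :=
  limn (fun n => \int[haar R]_x (F n x * walsh k x)).

Definition partial_sum (n : nat) F (x : dyadic) : R :=
  \sum_(k < n) walsh_coef F k * walsh k x.

End dyadic_hardy.

(* Main.v *)
(** Writing r for the Rademacher function of index n, the partial sum is
    f = F_n + r h, where h = E(r F_{n+1} | zeta_{n-1}); indeed the Walsh
    functions of index 2^n + j with j < 2^(n-1) are the r w_j.  Since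
    E(r F_{n+1} | zeta_n) = r (F_{n+1} - F_n) pointwise, h x is the mean of
    that expression at x and at the point x' obtained from x by flipping
    coordinate n-1, whence |h x| <= F^* x + F^* x'.  As E(f | zeta_k) is F_k for
    k <= n and f for k > n, the maximal function of f at x is at most
    2 F^* x + F^* x', and the flip preserves Haar measure. *)
From HB Require Import structures.
Require Import Defs.
From mathcomp Require Import all_boot all_order all_algebra.
From mathcomp Require Import all_classical all_reals all_analysis.
From mathcomp Require Import measurable_realfun.
From mathcomp Require Import zify ring lra.

Set Implicit Arguments.
Unset Strict Implicit.
Unset Printing Implicit Defensive.

Import Order.TTheory GRing.Theory Num.Theory.
Import numFieldNormedType.Exports.
Local Open Scope classical_set_scope.
Local Open Scope ring_scope.

(** * Cylinders and the flip of one coordinate, a translation of the group *)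

Definition flip (j : nat) (x : dyadic) : dyadic :=
  fun k => if k == j then x k + 1 else x k.

Lemma Z2_cases (a b : 'Z_2) : (b == a) || (b == a + 1).
Proof. by case: a b => [[|[|a]] ha] [[|[|b]] hb]. Qed.

Lemma Z2_add1 (a : 'Z_2) : (a + 1 == a) = false.
Proof. by case: a => [[|[|a]] ha]. Qed.

Lemma Z2_addK (a : 'Z_2) : a + 1 + 1 = a.
Proof. by case: a => [[|[|a]] ha]; apply/val_inj. Qed.

Lemma flipK j : involutive (flip j).
Proof.
move=> x; apply/funext => k; rewrite /flip.
by case: eqP => // _; rewrite Z2_addK.
Qed.

Lemma cylinder_sym m (x y : dyadic) : cylinder m x y -> cylinder m y x.
Proof. by move=> h k km; rewrite h. Qed.

Lemma cylinder_trans m (x y z : dyadic) :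
  cylinder m x y -> cylinder m y z -> cylinder m x z.
Proof. by move=> h h' k km; rewrite h' // h. Qed.

Lemma cylinder_le m m' (x y : dyadic) :
  (m <= m')%N -> cylinder m' x y -> cylinder m x y.
Proof. by move=> mm h k km; apply: h; exact: leq_trans mm. Qed.

Lemma cylinder_flip m (x : dyadic) : cylinder m x (flip m x).
Proof. by move=> k km; rewrite /flip ltn_eqF. Qed.

Lemma preimage_flip_cylinder j m (x : dyadic) :
  flip j @^-1` cylinder m x = cylinder m (flip j x).
Proof.
apply/seteqP; split => y h k km.
  by rewrite -(flipK j y) [LHS]/flip [RHS]/flip h.
by rewrite [LHS]/flip h // -[RHS](f_equal (fun z => z k) (flipK j x)).
Qed.

Lemma cylinderS m (x : dyadic) :
  cylinder m x = cylinder m.+1 x `|` cylinder m.+1 (flip m x).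
Proof.
apply/seteqP; split => y; last first.
  case=> /(cylinder_le  (leqnSn m)) //.
  exact/cylinder_trans/cylinder_flip.
move=> h; have /orP[/eqP ym|/eqP ym] := Z2_cases (x m) (y m); [left|right];
  move=> k; rewrite ltnS leq_eqVlt => /orP[/eqP->|km] //.
- exact: h.
- by rewrite /flip eqxx.
- by rewrite h // cylinder_flip.
Qed.

Lemma cylinderS_disj m (x : dyadic) :
  [disjoint cylinder m.+1 x & cylinder m.+1 (flip m x)].
Proof.
apply/disj_setPS => y [/(_ m (ltnSn m)) h /(_ m (ltnSn m))].
by move/eqP; rewrite h /flip eqxx eq_sym Z2_add1.
Qed.

(** * Dependence on the first coordinates and the sigma-algebras [zeta m] *)

Lemma measurable_cylinder m (x : dyadic) :
  measurable (cylinder m x : set dyadic).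
Proof. by apply: sub_sigma_algebra; exists m, x. Qed.

(** [T] is [Prop] for sets and [R] for real functions, so one notion covers both. *)
Definition depends (T : Type) (m : nat) (f : dyadic -> T) :=
  forall x y, cylinder m x y -> f y = f x.

Lemma depends_le (T : Type) m m' (f : dyadic -> T) :
  (m <= m')%N -> depends m f -> depends m' f.
Proof. by move=> mm h x y /(cylinder_le mm)/h. Qed.

(** The sets that depend on the first [m] coordinates form a sigma-algebra containing the generating
    cylinders. *)
Lemma zeta_depends m (A : set dyadic) : zeta m A -> depends m A.
Proof.
pose S := [set A : set dyadic | depends m A].
suff : zeta m `<=` S by exact.
apply: smallest_sub; last first.
  move=> _ [z _ <-] x y xy; apply/propext; split => h.
    exact/(cylinder_trans h)/cylinder_sym.
  exact: cylinder_trans h xy.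
split=> [//|B SB x y xy|F SF x y xy].
  by rewrite /setD /mkset (SB _ _ xy).
apply/propext; split => -[i _ Fi]; exists i => //.
  by rewrite -(SF i _ _ xy).
by rewrite (SF i _ _ xy).
Qed.

Lemma depends_zeta m (A : set dyadic) : depends m A -> zeta m A.
Proof.
move=> hA.
(* A word of length [m] is padded with zeros. [pickle] numbers these words, so [A] becomes a
   countable union of cylinders; indices coding no word contribute the empty set. *)
pose ext (c : {ffun 'I_m -> 'Z_2}) : dyadic :=
  fun k => if insub k is Some i then c i else 0.
pose B i : set dyadic := if unpickle i is Some c then
   [set y | cylinder m (ext c) y /\ A (ext c)] else set0.
have -> : A = \bigcup_i B i.
  apply/seteqP; split=> [x Ax|x [i _]].
    pose c := [ffun i : 'I_m => x i].
    have hc : cylinder m (ext c) x.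
      by move=> k km; rewrite /ext insubT /= ffunE.
    exists (pickle c) => //; rewrite /B pickleK /=; split=> //.
    by rewrite -(hA _ _ hc).
  by rewrite /B; case: unpickle => // c [/hA ->].
apply: sigma_algebra_bigcup => i; rewrite /B.
case: unpickle => [c|]; last exact: sigma_algebra0.
have [h|h] := pselect (A (ext c)).
  have -> : [set y | cylinder m (ext c) y /\ A (ext c)] = cylinder m (ext c).
    by apply/seteqP; split=> y // [].
  by apply: sub_sigma_algebra; exists (ext c).
have -> : [set y | cylinder m (ext c) y /\ A (ext c)] = set0.
  by rewrite -subset0 => y [].
exact: sigma_algebra0.
Qed.

Lemma zeta_sub m (A : set dyadic) : zeta m A -> measurable A.
Proof.
apply: smallest_sub; first exact: smallest_sigma_algebra.
by move=> _ [x _ <-]; exact: measurable_cylinder.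
Qed.

Lemma depends_measurable d (T : measurableType d) m (f : dyadic -> T) :
  depends m f -> measurable_fun setT f.
Proof.
move=> hf _ B mB; rewrite setTI; apply: (@zeta_sub m).
by apply: depends_zeta => x y xy; rewrite /preimage /= (hf _ _ xy).
Qed.

Lemma measurable_flip j : measurable_fun [set: dyadic] (flip j).
Proof.
apply: (@measurability _ _ _ dyadic setT (flip j) cylinders) => //.
move=> _ [_ [m [x ->]] <-]; rewrite setTI preimage_flip_cylinder.
exact: measurable_cylinder.
Qed.

(** * Averages over cylinders as conditional expectations *)

Section dyadic_martingale.
Variable R : realType.
Local Notation mu := (haar R).
Local Notation intf f := (mu.-integrable [set: dyadic] (EFin \o f)).
Implicit Types (f g : dyadic -> R).

Lemma haar_cylinder m (x : dyadic) : mu (cylinder m x) = (2 ^- m)%:E.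
Proof.
have -> : cylinder m x =
    [set y : dyadic | forall k, (k < m)%N -> y k \in [set x k]%SET].
  by apply/seteqP; split=> y h k km; have := h k km; rewrite inE => /eqP.
rewrite haarP (eq_bigr (fun=> 2^-1)); last by move=> i _; rewrite cards1 div1r.
by rewrite prodr_const card_ord exprVn.
Qed.

Lemma measurable_wrt_depends m f : measurable_wrt (zeta m) f -> depends m f.
Proof.
move=> hf x y xy.
have /hf/zeta_depends/(_ _ _ xy) := measurable_set1 (f x).
by rewrite /preimage /= => ->.
Qed.

(** [2 ^+ m] is the inverse of the measure of the cylinder, so for integrable [f] this is the
    everywhere defined version of E(f | zeta_m). *)
Definition avg m f x : R := 2 ^+ m * \int[mu]_(y in cylinder m x) f y.

Lemma avg_depends m f : depends m (avg m f).
Proof.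
move=> x y xy; rewrite /avg; congr (_ * Rintegral _ _ _).
apply/seteqP; split=> z; first exact: cylinder_trans.
exact/cylinder_trans/cylinder_sym.
Qed.

Lemma avgS m f x : intf f ->
  avg m f x = (avg m.+1 f x + avg m.+1 f (flip m x)) / 2.
Proof.
move=> hf; rewrite /avg cylinderS Rintegral_setU.
- by rewrite exprSr -mulrDr mulrAC mulfK.
- exact: measurable_cylinder.
- exact: measurable_cylinder.
- apply: (integrableS _ _ _ hf) => //.
  by apply: measurableU; exact: measurable_cylinder.
- exact: cylinderS_disj.
Qed.

Lemma avg_mull m f g x : intf f -> depends m g ->
  avg m (fun y => g y * f y) x = g x * avg m f x.
Proof.
move=> hf hg; rewrite /avg.
under eq_Rintegral.
  move=> y; rewrite inE => xy; rewrite (hg _ _ xy); over.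
rewrite /= RintegralZl; first by ring.
- exact: measurable_cylinder.
- exact: (integrableS _ (measurable_cylinder _ _) _ hf).
Qed.

Lemma avg_id m f x : depends m f -> avg m f x = f x.
Proof.
move=> hf; rewrite /avg.
under eq_Rintegral.
  move=> y; rewrite inE => xy; rewrite (hf _ _ xy); over.
rewrite /= Rintegral_cst; last exact: measurable_cylinder.
rewrite [fine _](_ : _ = 2 ^- m); last first.
  exact: (f_equal fine (haar_cylinder m x)).
by field; rewrite expf_neq0.
Qed.

(** Tower property: by [avgS] a coarser average is a mean of two finer ones, so equality descends
    one level at a time. *)
Lemma eq_avg_le k m f g : (k <= m)%N -> intf f -> intf g ->
  avg m f =1 avg m g -> avg k f =1 avg k g.
Proof.
move=> km hf hg; elim: m km => [|m IH]; first by rewrite leqn0 => /eqP ->.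
rewrite leq_eqVlt => /orP[/eqP -> //|km h]; apply: IH => // x.
by rewrite (avgS m x hf) (avgS m x hg) !h.
Qed.

(** [g] is constant on cylinders of order [m], hence equal to its own average, and these cylinders
    belong to [zeta m], where [g] and [f] have the same integrals. *)
Lemma cond_exp_avg m f g : is_cond_exp (zeta m) f g -> g =1 avg m f.
Proof.
case=> mg ig hg x; rewrite -(@avg_id m g x); last exact: measurable_wrt_depends.
rewrite /avg hg //; by apply: sub_sigma_algebra; exists x.
Qed.

(** * Rademacher and Walsh functions *)

Lemma rademacher_depends k : depends k.+1 (@rademacher R k).
Proof. by move=> x y xy; rewrite /rademacher xy. Qed.

Lemma rademacher_flip k x : rademacher R k (flip k x) = - rademacher R k x.
Proof.
rewrite /rademacher /flip eqxx.
by case: (x k) => [[|[|a]] ha] //=; rewrite ?expr0 ?expr1 ?opprK.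
Qed.

Lemma rademacher_sqr k x : rademacher R k x * rademacher R k x = 1.
Proof. by rewrite -expr2 sqrr_sign. Qed.

Lemma normr_rademacher k x : `|rademacher R k x| = 1.
Proof. by rewrite /rademacher normr_sign. Qed.

Lemma avg_rademacher m f x : intf f ->
  avg m.+1 (fun y => rademacher R m y * f y) x = rademacher R m x * avg m.+1 f x.
Proof. by move=> hf; apply: avg_mull => //; exact: rademacher_depends. Qed.

Lemma integrable_bounded_mull m f g :
  depends m g -> (forall x, `|g x| <= 1) -> intf f ->
  intf (fun x => g x * f x).
Proof.
move=> hg g1 hf.
rewrite (_ : EFin \o _ = ((EFin \o g) \* (EFin \o f))%E); last first.
  by apply/funext => x /=; rewrite EFinM.
apply: integrableMr => //; first exact: depends_measurable hg.
by exists 1; split => // M M1 x _ /=; rewrite (le_trans (g1 x)) // ltW.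
Qed.

Lemma integrable_rademacher k f : intf f -> intf (fun x => rademacher R k x * f x).
Proof.
move=> hf; apply: integrable_bounded_mull hf; first exact: rademacher_depends.
by move=> x; rewrite normr_rademacher.
Qed.

(** The two halves of the cylinder get opposite signs, so the mean of [avgS] turns into a
    difference. *)
Lemma avg_rademacher_flip m f x : intf f ->
  avg m (fun y => rademacher R m y * f y) x =
  rademacher R m x * (avg m.+1 f x - avg m.+1 f (flip m x)) / 2.
Proof.
move=> hf; rewrite avgS ?avg_rademacher ?rademacher_flip; first by ring.
- exact: hf.
- exact: hf.
- exact: integrable_rademacher.
Qed.

(** Digits of [n] beyond its length vanish, so any long enough product has the same value; both are
    compared with the one of length [maxn n N]. *)
Lemma walsh_prod_widen n N (x : dyadic) : (n < 2 ^ N)%N ->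
  walsh R n x = \prod_(k < N) rademacher R k x ^+ odd (n %/ 2 ^ k).
Proof.
pose F k : R := rademacher R k x ^+ odd (n %/ 2 ^ k).
have ext a b : (n < 2 ^ a)%N -> (a <= b)%N ->
    \prod_(k < b) F k = \prod_(k < a) F k.
  move=> na; elim: b => [|b IH]; first by rewrite leqn0 => /eqP ->.
  rewrite leq_eqVlt => /orP[/eqP -> //|ab].
  rewrite big_ord_recr IH //= /F divn_small ?mulr1 //.
  by apply: leq_trans na _; rewrite leq_exp2l.
move=> nN; have nn : (n < 2 ^ n)%N by exact: ltn_expl.
exact: etrans (esym (ext _ _ nn (leq_maxl n N))) (ext _ _ nN (leq_maxr n N)).
Qed.

Lemma walsh_depends n N : (n < 2 ^ N)%N -> depends N (@walsh R n).
Proof.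
move=> nN x y xy; rewrite !(walsh_prod_widen _ nN); apply: eq_bigr => i _.
by rewrite /rademacher xy.
Qed.

Lemma normr_walsh n x : `|walsh R n x| = 1.
Proof.
rewrite normr_prod big1 // => i _.
by rewrite normrX normr_rademacher expr1n.
Qed.

Lemma integrable_walsh k f : intf f -> intf (fun x => walsh R k x * f x).
Proof.
move=> hf; apply: integrable_bounded_mull hf.
  exact: walsh_depends (ltn_expl k _).
by move=> x; rewrite normr_walsh.
Qed.

Lemma walsh_add_pow m j x : (j < 2 ^ m)%N ->
  walsh R (2 ^ m + j) x = rademacher R m x * walsh R j x.
Proof.
move=> jm; have jm1 : (2 ^ m + j < 2 ^ m.+1)%N by rewrite expnS; lia.
rewrite (walsh_prod_widen _ jm1) (walsh_prod_widen _ jm) big_ord_recr /= mulrC.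
rewrite divnDl // divnn expn_gt0 /= divn_small // expr1; congr (_ * _).
apply: eq_bigr => i _; rewrite divnDl ?dvdn_exp2l // 1?ltnW //.
(* For [i < m] the quotient 2^(m-i) is even and leaves the parity giving digit [i] of [j]
   unchanged. *)
rewrite -expnB // 1?ltnW // oddD oddX /= subn_eq0 leqNgt ltn_ord //.
Qed.

(** The classical identity S_{2^m} f = E(f | zeta_m). By induction: the upper half of the block of
    indices below 2^(m+1) contributes r_m times the sum S_{2^m} of r_m f. *)
Lemma walsh_expansion m f x : intf f ->
  \sum_(j < 2 ^ m) (\int[mu]_y (f y * walsh R j y)) * walsh R j x = avg m f x.
Proof.
elim: m f x => [|m IH] f x hf.
  rewrite expn0 big_ord1 /avg expr0 mul1r /walsh big_ord0 mulr1.
  rewrite (_ : cylinder 0 x = setT); last by apply/seteqP; split.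
  by apply: eq_Rintegral => y _; rewrite big_ord0 mulr1.
rewrite expnS mul2n -addnn big_split_ord /= IH //.
pose g y := rademacher R m y * f y.
have hg : intf g by exact: integrable_rademacher.
transitivity (avg m f x + rademacher R m x * avg m g x).
  congr (_ + _); rewrite -(IH g) // mulr_sumr; apply: eq_bigr => j _.
  rewrite walsh_add_pow // mulrCA; congr (_ * (_ * _)).
  by apply: eq_Rintegral => y _; rewrite walsh_add_pow // mulrA [f y * _]mulrC.
(* As r_m^2 = 1, the two parts are (a + b)/2 and (a - b)/2, where a and b are the averages over the
   two halves; they add up to a. *)
rewrite avg_rademacher_flip // !mulrA rademacher_sqr mul1r (avgS m x hf); by field.
Qed.

(** Conditional expectations are specified by integrals over sets; splitting by sign reduces an
    integral against a Walsh function to such integrals. *)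
Lemma Rintegral_sign_split m f g : intf f -> depends m g -> (forall x, `|g x| = 1) ->
  \int[mu]_y (f y * g y) =
  \int[mu]_(y in [set y | g y = 1]) f y - \int[mu]_(y in [set y | g y != 1]) f y.
Proof.
move=> hf hg g1.
have m1 : measurable [set y : dyadic | g y = 1].
  by apply: (@zeta_sub m); apply: depends_zeta => x y xy; rewrite /mkset (hg _ _ xy).
have m2 : measurable [set y : dyadic | g y != 1].
  by apply: (@zeta_sub m); apply: depends_zeta => x y xy; rewrite /mkset (hg _ _ xy).
have U : [set y : dyadic | g y = 1] `|` [set y | g y != 1] = setT.
  by apply/seteqP; split => // y _ /=; case: (eqVneq (g y) 1); [left|right].
have hfg : intf (fun y => f y * g y).
  under [X in EFin \o X]eq_fun do rewrite mulrC.
  by apply: integrable_bounded_mull hf; first exact: hg; move=> x; rewrite g1.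
rewrite -U Rintegral_setU //.
- congr (_ + _).
    by apply: eq_Rintegral => y; rewrite inE /= => ->; rewrite mulr1.
  rewrite -mulN1r -RintegralZl //; last exact: integrableS hf.
  apply: eq_Rintegral => y; rewrite inE /= => /negPf y1.
  have /eqP := g1 y; rewrite eqr_norml y1 /= => /andP[/eqP -> _].
  by rewrite mulrC.
- by rewrite U.
- by apply/disj_setPS => y [/= -> /eqP].
Qed.

(** * Walsh coefficients and partial sums of a martingale *)

Section partial_sum.
Variable F : nat -> dyadic -> R.
Hypothesis mF : is_martingale F.

Let intF n : intf (F n). Proof. exact: mF.1. Qed.

Lemma martingale_depends n : depends n (F n).
Proof.
by case: (mF.2 n n (leqnn n)) => h _ _; exact: measurable_wrt_depends.
Qed.

Lemma martingale_avg n m x : (n <= m)%N -> avg n (F m) x = F n x.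
Proof. by move=> nm; rewrite (cond_exp_avg (mF.2 m n nm)). Qed.

(** The level sets of w_k lie in [zeta m], so the sequence defining the coefficient is constant from
    index [m] on. *)
Lemma walsh_coef_martingale m k : (k < 2 ^ m)%N ->
  walsh_coef F k = \int[mu]_x (F m x * walsh R k x).
Proof.
move=> km; apply: (@lim_near_cst R) => //.
exists m => // n /= mn; rewrite !(Rintegral_sign_split _ (walsh_depends km)) //;
  try exact: normr_walsh.
have [_ _ h] := mF.2 n m mn.
by rewrite !h //; apply: depends_zeta => x y xy;
  rewrite /mkset (walsh_depends km xy).
Qed.

(** The index is shifted: [n.+1] is the n of the theorem. The first 2^(n+1) terms sum to F_{n+1};
    the others involve the products r w_j, and their coefficients are those of r F_{n+2}. *)
Lemma partial_sum_martingale n x :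
  partial_sum (2 ^ n.+1 + 2 ^ n) F x =
  F n.+1 x + rademacher R n.+1 x * avg n (fun y => rademacher R n.+1 y * F n.+2 y) x.
Proof.
rewrite /partial_sum big_split_ord /=; congr (_ + _).
  rewrite -[RHS](martingale_avg _ (leqnn _)) -walsh_expansion //.
  by apply: eq_bigr => j _; rewrite (walsh_coef_martingale (ltn_ord j)).
rewrite -walsh_expansion; last exact: integrable_rademacher.
rewrite mulr_sumr; apply: eq_bigr => j _.
have jn : (j < 2 ^ n.+1)%N.
  by apply: leq_trans (ltn_ord j) _; rewrite leq_exp2l.
have jn2 : (2 ^ n.+1 + j < 2 ^ n.+2)%N by rewrite (expnS 2 n.+1); lia.
rewrite (walsh_coef_martingale jn2) walsh_add_pow // mulrCA; congr (_ * (_ * _)).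
by apply: eq_Rintegral => y _; rewrite walsh_add_pow // mulrA [F _ y * _]mulrC.
Qed.

End partial_sum.

(** * Invariance of Haar measure under flips *)

Lemma haar_flip j (A : set dyadic) : measurable A -> mu (flip j @^-1` A) = mu A.
Proof.
pose X : {mfun dyadic >-> dyadic} :=
  HB.pack (flip j) (isMeasurableFun.Build _ _ _ _ _ (measurable_flip j)).
(* Both measures agree on cylinders; adding the empty set makes this family stable under
   intersection. *)
pose G : set (set dyadic) := cylinders `|` [set set0].
apply: (measure_unique G (fun=> cylinder 0 0) _ _ _ _ (distribution mu X) mu).
- apply/seteqP; split; first by apply: sub_sigma_algebra2 => A0; left.
  apply: smallest_sub; first exact: smallest_sigma_algebra.
  by move=> _ [[m [x ->]]| ->]; [exact: measurable_cylinder|exact: measurable0].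
- move=> _ B [[m [x ->]]| ->]; last by rewrite set0I; right.
  case=> [[k [y ->]]| ->]; last by rewrite setI0; right.
  (* Cylinders that share a point [z] meet in the cylinder around [z] of the larger order. *)
  have [->|/set0P[z [xz yz]]] := eqVneq (cylinder m x `&` cylinder k y) set0.
    by right.
  left; exists (maxn m k), z; apply/seteqP; split => w.
    move=> [xw yw] i; rewrite leq_max => /orP[im|ik].
      by rewrite xw // xz.
    by rewrite yw // yz.
  move=> zw; split => i ik.
    by rewrite zw ?xz // leq_max ik.
  by rewrite zw ?yz // leq_max ik orbT.
- by move=> i; left; exists 0%N, 0.
- by apply/seteqP; split => // x _; exists 0%N.
- move=> _ [[m [x ->]]| ->]; last by rewrite !measure0.
  rewrite [LHS]/(mu (flip j @^-1` cylinder m x)) preimage_flip_cylinder.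
  exact: etrans (haar_cylinder _ _) (esym (haar_cylinder _ _)).
- move=> k; apply: (le_lt_trans (probability_le1 _ _)); last by rewrite ltry.
  exact: measurable_cylinder.
Qed.

Lemma ge0_integral_flip j (f : dyadic -> \bar R) :
  measurable_fun [set: dyadic] f -> (forall x, 0 <= f x)%E ->
  (\int[mu]_x f (flip j x) = \int[mu]_x f x)%E.
Proof.
move=> mf f0.
pose X : {mfun dyadic >-> dyadic} :=
  HB.pack (flip j) (isMeasurableFun.Build _ _ _ _ _ (measurable_flip j)).
rewrite -[LHS](ge0_integral_distribution X mf f0).
by apply: eq_measure_integral => A mA _; exact: haar_flip.
Qed.

(** * Maximal functions and conditional expectations *)

Lemma maximal_ge (F : nat -> dyadic -> R) k x : (`|F k x|%:E <= maximal F x)%E.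
Proof. by apply: ereal_sup_ubound; exists k. Qed.

Lemma maximal_ge0 (F : nat -> dyadic -> R) x : (0 <= maximal F x)%E.
Proof. by apply: le_trans (maximal_ge F 0 x); rewrite lee_fin. Qed.

Lemma measurable_maximal (F : nat -> dyadic -> R) :
  (forall k, measurable_fun [set: dyadic] (F k)) ->
  measurable_fun [set: dyadic] (maximal F).
Proof.
move=> mF; pose u k x := `|F k x|%:E.
(* [esups] at index 0 is the supremum over all indices. *)
rewrite (_ : maximal F = fun x => esups (u ^~ x) 0).
  apply: measurable_fun_esups => k; apply/measurable_EFinP.
  exact: measurableT_comp.
apply/funext => x; rewrite /maximal /esups /sdrop; congr ereal_sup.
by apply/seteqP; split => y [k _ <-]; exists k.
Qed.

(* [cond_exp] has the junk value 0 when no conditional expectation exists; this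
   only helps an upper bound, so existence is never needed. *)
Lemma cond_exp_zetaP k f : cond_exp (zeta k) f = cst 0 \/
  is_cond_exp (zeta k) f (cond_exp (zeta k) f).
Proof. by rewrite /cond_exp; case: xgetP => [g -> h|_]; [right|left]. Qed.

Lemma measurable_cond_exp k f : measurable_fun [set: dyadic] (cond_exp (zeta k) f).
Proof.
case: (cond_exp_zetaP k f) => [->|[/measurable_wrt_depends h _ _]].
  exact: measurable_cst.
exact: depends_measurable h.
Qed.

Lemma normr_cond_exp_le k f x : `|cond_exp (zeta k) f x| <= `|avg k f x|.
Proof.
case: (cond_exp_zetaP k f) => [->|/cond_exp_avg ->] //.
by rewrite normr0.
Qed.

Lemma integrable_partial_sum n (F : nat -> dyadic -> R) : intf (partial_sum n F).
Proof.
rewrite (_ : EFin \o _ = fun x => \sum_(k < n)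
    (EFin \o (fun y => walsh R k y * walsh_coef F k)%R) x)%E; last first.
  apply/funext => x; rewrite sumEFin; congr EFin.
  by apply: eq_bigr => k _; rewrite mulrC.
apply: (integrable_sum measurableT) => k _; apply: integrable_walsh.
exact: finite_measure_integrable_cst.
Qed.

(** * Pointwise bound for the maximal function of the partial sum *)

Section maximal_partial_sum.
Variables (F : nat -> dyadic -> R) (n : nat).
Hypothesis mF : is_martingale F.

Let f := partial_sum (2 ^ n.+1 + 2 ^ n) F.
Let r := rademacher R n.+1.
Let h := avg n (fun y => r y * F n.+2 y).

Let fE x : f x = F n.+1 x + r x * h x.
Proof. exact: partial_sum_martingale. Qed.

Let h_depends : depends n.+1 h.
Proof. exact/(depends_le (leqnSn n))/avg_depends. Qed.

Let f_depends : depends n.+2 f.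
Proof.
move=> x y xy; have xy1 := cylinder_le (leqnSn _) xy.
rewrite !fE (martingale_depends mF xy1) (h_depends xy1).
by rewrite /r (rademacher_depends xy).
Qed.

(** On each cylinder of order n+1 the term r h has mean zero: flipping coordinate n+1 changes the
    sign of r and fixes h. Thus [f] and F_{n+1} have the same averages there and at all coarser
    levels. *)
Lemma avg_partial_sum k x : (k <= n.+1)%N -> avg k f x = F k x.
Proof.
move=> kn; rewrite -(martingale_avg mF x kn).
apply: (@eq_avg_le _ n.+1) => // [||y].
- exact: integrable_partial_sum.
- exact: mF.1.
rewrite (martingale_avg mF) // avgS; last exact: integrable_partial_sum.
rewrite !(avg_id _ f_depends) !fE /r rademacher_flip.
have yy := @cylinder_flip n.+1 y.
by rewrite (martingale_depends mF yy) (h_depends yy); field.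
Qed.

(** Writing F_{n+1} as the mean of F_{n+2} at [x] and at [flip n.+1 x] turns both sides into r times
    half the difference of these two values. *)
Lemma avg_difference x :
  avg n.+1 (fun y => r y * F n.+2 y) x = r x * (F n.+2 x - F n.+1 x).
Proof.
have iF := mF.1 n.+2.
have -> : F n.+1 x = (F n.+2 x + F n.+2 (flip n.+1 x)) / 2.
  rewrite -(martingale_avg mF x (leqnSn n.+1)) avgS //.
  by rewrite !(avg_id _ (martingale_depends mF (n := n.+2))).
rewrite avg_rademacher_flip // !(avg_id _ (martingale_depends mF (n := n.+2))).
by rewrite -/r; field.
Qed.

(** One averaging step from level n+1 to n brings in the point [flip n x]; [avg_difference] is then
    applied at both points. *)
Lemma normr_avg_le x : `|h x| <=
  (`|F n.+2 x| + `|F n.+1 x| + (`|F n.+2 (flip n x)| + `|F n.+1 (flip n x)|)) / 2.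
Proof.
have B y : `|r y * (F n.+2 y - F n.+1 y)| <= `|F n.+2 y| + `|F n.+1 y|.
  by rewrite normrM normr_rademacher mul1r ler_normB.
rewrite /h avgS; last exact/integrable_rademacher/mF.1.
rewrite !avg_difference normrM (@ger0_norm _ 2^-1) ?invr_ge0 //.
by rewrite ler_pM2r ?invr_gt0 // (le_trans (ler_normD _ _)) // lerD.
Qed.

Lemma maximal_partial_sum_le x :
  (maximal (fun k => cond_exp (zeta k) f) x <=
   maximal F x + maximal F x + maximal F (flip n x))%E.
Proof.
apply: ub_ereal_sup => _ [k _ <-].
apply: (@le_trans _ _ `|avg k f x|%:E); first by rewrite lee_fin normr_cond_exp_le.
have := maximal_ge0 F x; have := maximal_ge0 F (flip n x).
have [kn|kn] := leqP k n.+1.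
  move=> m0 m1; rewrite avg_partial_sum //.
  apply: (le_trans (maximal_ge F k x)); rewrite -addeA leeDl //.
  by rewrite adde_ge0.
rewrite (avg_id _ (depends_le kn f_depends)) fE.
have := normr_avg_le x.
move: (maximal_ge F n.+2 x) (maximal_ge F n.+1 x)
  (maximal_ge F n.+2 (flip n x)) (maximal_ge F n.+1 (flip n x)).
(* If a maximal value is +oo, so is the right-hand side; nonnegativity rules out -oo. *)
case: (maximal F x) => [M| |] //; last first.
  by case: (maximal F (flip n x)) => [M'| |] //= *; exact: leey.
case: (maximal F (flip n x)) => [M'| |] //; last by move=> *; exact: leey.
rewrite -!EFinD !lee_fin => h1 h2 h3 h4 h5 _ _.
(* |h| is at most half of 2M + 2M', and |F_{n+1}| at most M: in all 2M + M'. *)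
have : `|F n.+1 x + r x * h x| <= `|F n.+1 x| + `|h x|.
  by rewrite (le_trans (ler_normD _ _)) // normrM normr_rademacher mul1r.
lra.
Qed.

End maximal_partial_sum.

(** * From the pointwise bound to the quasi-norm *)

Lemma poweR_add_le (p : R) (a b : \bar R) : 0 < p -> (0 <= a)%E -> (0 <= b)%E ->
  ((a + a + b) `^ p <= (3 `^ p)%:E * (a `^ p + b `^ p))%E.
Proof.
move=> p0 a0 b0.
(* [M] is the larger of [a] and [b]: then a + a + b is at most 3M, and M^p is one of the two
   summands. *)
wlog M : a b a0 b0 / exists M : \bar R, [/\ (0 <= M)%E, (a <= M)%E, (b <= M)%E &
  (M `^ p <= a `^ p + b `^ p)%E].
  apply => //; have [ab|ba] := leP a b.
    by exists b; split => //; rewrite leeDr // poweR_ge0.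
  by exists a; split => //; [exact: ltW|rewrite leeDl // poweR_ge0].
case: M => M [M0 aM bM hM].
apply: (@le_trans _ _ ((3%:E * M) `^ p)%E); last first.
  rewrite poweRM // poweR_EFin; by rewrite lee_pmul2l ?lte_fin ?powR_gt0.
have e : (3%:E * M = M + M + M)%E.
  have -> : (3%:E = 1 + 1 + 1 :> \bar R)%E by rewrite -!EFinD; congr EFin; ring.
  by rewrite !ge0_muleDl ?adde_ge0 // !mul1e.
apply: gt0_ler_poweR; rewrite ?(ltW p0) ?in_itv /= ?leey ?andbT ?adde_ge0 //.
  by rewrite mule_ge0.
by rewrite e; do 2 apply: leeD => //.
Qed.

End dyadic_martingale.

Theorem corollary3 (R : realType) (p : R) (hp0 : 0 < p) (hp1 : p <= 1) :
  exists c : R, forall (n : nat) (F : nat -> dyadic -> R),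
    (0 < n)%N -> in_Hp p F ->
    (fun_Hp_norm p (partial_sum (2 ^ n + 2 ^ n.-1) F) <= c%:E * Hp_norm p F)%E.
Proof.
(* 3^p comes from [poweR_add_le], 2 from the equal integrals of the p-th power of the maximal
   function and of its flip, and the exponent 1/p from the norm. *)
exists ((3 `^ p * 2) `^ p^-1) => -[//|n] F _ [mF _] /=.
rewrite /fun_Hp_norm /Hp_norm unlock.
set f := partial_sum _ F; set G := maximal (fun k => cond_exp (zeta k) f).
have G0 x : (0 <= G x)%E by exact: maximal_ge0.
have F0 x : (0 <= maximal F x)%E by exact: maximal_ge0.
have mF' : measurable_fun [set: dyadic] (maximal F).
  apply: measurable_maximal => k.
  exact: depends_measurable (martingale_depends mF (n := k)).
have mG : measurable_fun [set: dyadic] G.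
  by apply: measurable_maximal => k; exact: measurable_cond_exp.
have mFp : measurable_fun [set: dyadic] (fun x => maximal F x `^ p)%E.
  exact: measurableT_comp (measurable_poweR p) mF'.
have mFp' : measurable_fun [set: dyadic] (fun x => maximal F (flip n x) `^ p)%E.
  exact: measurableT_comp mFp (measurable_flip n).
under eq_integral do rewrite gee0_abs //.
under [in leRHS]eq_integral do rewrite gee0_abs //.
set I := (X in (_ <= _ * X `^ _)%E).
have I0 : (0 <= I)%E by apply: integral_ge0 => x _; exact: poweR_ge0.
have c0 : (0 <= (3 `^ p * 2)%:E :> \bar R)%E by rewrite lee_fin mulr_ge0 // powR_ge0.
(* The constant moves inside the power 1/p, and monotonicity of that power leaves an inequality of
   integrals. *)
rewrite -poweR_EFin -poweRM //.
apply: gt0_ler_poweR; rewrite ?invr_ge0 ?(ltW hp0) ?in_itv /= ?leey ?andbT //.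
- by apply: integral_ge0 => x _; exact: poweR_ge0.
- exact: mule_ge0.
apply: (@le_trans _ _ (\int[haar R]_x
    ((3 `^ p)%:E * (maximal F x `^ p + maximal F (flip n x) `^ p)))%E).
  apply: ge0_le_integral => //.
  - by move=> x _; exact: poweR_ge0.
  - exact: measurableT_comp (measurable_poweR p) mG.
  - by apply: measurable_funeM; exact: emeasurable_funD.
  - move=> x _; apply: le_trans (poweR_add_le hp0 _ _) => //.
    apply: gt0_ler_poweR; rewrite ?(ltW hp0) ?in_itv /= ?leey ?andbT ?adde_ge0 //.
    exact: maximal_partial_sum_le.
rewrite ge0_integralZl //; first last.
- by move=> x _; rewrite adde_ge0 // poweR_ge0.
- exact: emeasurable_funD.
rewrite ge0_integralD //; [|by move=> x _; exact: poweR_ge0..].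
(* Flip invariance makes the second integral another copy of [I]. *)
rewrite (@ge0_integral_flip _ n (fun x => maximal F x `^ p)%E) //; last first.
  by move=> x; exact: poweR_ge0.
by rewrite -/I EFinM -muleA mule_natl mule2n.
Qed.
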